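(* For every $\varepsilon>0$ there exists an instance $\mathcal{I}$ of the Strip Packing Problem such that $$\frac{h_{\text{BL}}^{\text{best}}(\mathcal{I})}{h_{\text{OPT}}(\mathcal{I})}\ \ge\ \frac43-\varepsilon ;$$ i.e., the approximation ratio of the bottom-left algorithm for the Strip Packing Problem cannot be better than $4/3-\varepsilon$, even if the rectangles are ordered in the best possible way.
   Context: Strip Packing Problem (SPP): given a strip width $W>0$ and rectangles $r_1,\dots,r_n$ with widths $w_i\le W$ and heights $h_i$, a packing assigns to each $r_i$ a lower-left corner $(x_i,y_i)$; it is feasible if $x_i\ge 0$, $x_i+w_i\le W$, $y_i\ge 0$ for all $i$, and the open rectangles $(x_i,x_i+w_i)\times(y_i,y_i+h_i)$ are pairwise disjoint. Rotations are not allowed. The height of a packing is $\max_i (y_i+h_i)$, and $h_{\text{OPT}}(\mathcal{I})$ is the minimum height of a feasible packing. Bottom-left algorithm: given an ordering $r_1,\dots,r_n$, place $r_1$ at $(0,0)$. Then, for $i=2,\dots,n$, place $r_i$ at a position $(x_i,y_i)$ such that the first $i$ rectangles form a feasible packing and $(y_i,x_i)$ is lexicographically minimal among all such positions. $h_{\text{BL}}^{\text{best}}(\mathcal{I})$ denotes the minimum, over all $n!$ orderings, of the height of the packing produced by the bottom-left algorithm. *)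

(* Defs.v *)
From Stdlib Require Import Reals Lra List Permutation.
Import ListNotations.
Open Scope R_scope.

Definition rect : Type := (R * R)%type.
Definition rw (r : rect) : R := fst r.
Definition rh (r : rect) : R := snd r.

(* A placed rectangle: a rectangle together with its lower-left corner (x, y). *)
Definition placed : Type := (rect * (R * R))%type.
Definition px (p : placed) : R := fst (snd p).
Definition py (p : placed) : R := snd (snd p).
Definition prect (p : placed) : rect := fst p.

Definition valid_instance (W : R) (rs : list rect) : Prop :=
  0 < W /\ rs <> [] /\
  Forall (fun r => 0 < rw r /\ rw r <= W /\ 0 < rh r) rs.

Definition in_open (p : placed) (a b : R) : Prop :=
  px p < a < px p + rw (prect p) /\ py p < b < py p + rh (prect p).

Definition interiors_disjoint (p q : placed) : Prop :=
  ~ (exists a b, in_open p a b /\ in_open q a b).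

Definition feasible (W : R) (l : list placed) : Prop :=
  (forall p, In p l -> 0 <= px p /\ px p + rw (prect p) <= W /\ 0 <= py p) /\
  (forall i j d, (i < j < length l)%nat ->
     interiors_disjoint (nth i l d) (nth j l d)).

Definition pheight (l : list placed) : R :=
  fold_right Rmax 0 (map (fun p => py p + rh (prect p)) l).

Definition packing_of (rs : list rect) (l : list placed) : Prop :=
  map prect l = rs.

(* Lexicographic order on pairs (y, x). *)
Definition lex_le (a b : R * R) : Prop :=
  fst a < fst b \/ (fst a = fst b /\ snd a <= snd b).

(* l is the packing produced by the bottom-left algorithm for the ordering
   map prect l: the first rectangle is at (0,0), and each rectangle k is
   placed at a position (x_k, y_k) such that the first k+1 rectangles form a
   feasible packing and (y_k, x_k) is lexicographically minimal among all such
   positions. *)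
Definition BL_packing (W : R) (l : list placed) : Prop :=
  (forall p l', l = p :: l' -> px p = 0 /\ py p = 0) /\
  (forall k d, (k < length l)%nat ->
     let p := nth k l d in
     feasible W (firstn k l ++ [p]) /\
     forall x y, feasible W (firstn k l ++ [(prect p, (x, y))]) ->
       lex_le (py p, px p) (y, x)).

Definition is_hOPT (W : R) (rs : list rect) (h : R) : Prop :=
  (exists l, packing_of rs l /\ feasible W l /\ pheight l = h) /\
  (forall l, packing_of rs l -> feasible W l -> h <= pheight l).

Definition is_hBL_best (W : R) (rs : list rect) (h : R) : Prop :=
  (exists l, Permutation rs (map prect l) /\ BL_packing W l /\ pheight l = h) /\
  (forall l, Permutation rs (map prect l) -> BL_packing W l -> h <= pheight l).

(* Main.v *)
(** The instance has heights 1, 2 - mu and 3 in a strip of width 33. The item of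
    height 3 and width 1 only serves to force the optimal height 3. The others
    form three rows of width 32: two items P, Q of width 13 and height 2 - mu,
    with P covering rows 1-2 and Q covering rows 2-3, next to unit-height items
    of widths 12, 7 in row 1, of width 3 in row 2 and of widths 8, 11 in row 3.
    Rows 1 and 3 are full and row 2 has slack 3. The bottom-left rule cannot put
    that slack where it is needed: because P is slightly lower than two unit
    items, the items of row 3 are attracted to the top of P first, and their
    widths then leave an unusable gap. No order beats the height 4 - 2 * mu
    of stacking P and Q.

    A lexicographically minimal position always has y equal to 0 or to the top
    of a placed item, and x equal to 0 or to the right side of a placed item. So
    all runs live on a finite grid whose order does not depend on mu when mu is
    small, and the claim on all orders is settled by an exhaustive search. *)

Require Import Defs.
From Stdlib Require Import Reals List Permutation Lra Lia ZArith Bool.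
Import ListNotations.
Open Scope R_scope.

(** * Separation, feasibility and single bottom-left steps over the reals *)

Definition right (p : placed) : R := px p + rw (prect p).
Definition top (p : placed) : R := py p + rh (prect p).

Definition positive (p : placed) : Prop := 0 < rw (prect p) /\ 0 < rh (prect p).

Definition separated (p q : placed) : Prop :=
  right p <= px q \/ right q <= px p \/ top p <= py q \/ top q <= py p.

Lemma disjoint_separated (p q : placed) :
  positive p -> positive q -> interiors_disjoint p q <-> separated p q.
Proof.
  unfold positive, interiors_disjoint, separated, in_open, right, top.
  intros [wp hp] [wq hq]; split.
  - intros no_common.
    destruct (Rle_dec (px p + rw (prect p)) (px q)) as [|n1]; [tauto|].
    destruct (Rle_dec (px q + rw (prect q)) (px p)) as [|n2]; [tauto|].
    destruct (Rle_dec (py p + rh (prect p)) (py q)) as [|n3]; [tauto|].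
    destruct (Rle_dec (py q + rh (prect q)) (py p)) as [|n4]; [tauto|].
    exfalso; apply no_common.
    (* The centre of the overlap of the two rectangles. *)
    exists ((Rmax (px p) (px q) +
             Rmin (px p + rw (prect p)) (px q + rw (prect q))) / 2),
           ((Rmax (py p) (py q) +
             Rmin (py p + rh (prect p)) (py q + rh (prect q))) / 2).
    split; split.
    all: unfold Rmax, Rmin; repeat destruct (Rle_dec _ _); lra.
  - intros sep (a & b & in_p & in_q); lra.
Qed.

Definition in_strip (W : R) (p : placed) : Prop :=
  0 <= px p /\ right p <= W /\ 0 <= py p.

Lemma feasible_snoc (W : R) (l : list placed) (p : placed) :
  feasible W (l ++ [p]) <->
  feasible W l /\ in_strip W p /\ (forall q, In q l -> interiors_disjoint q p).
Proof.
  unfold feasible, in_strip, right; split.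
  - intros [bounds disj]; repeat split.
    1-3: now apply bounds, in_or_app; left.
    2-4: now apply bounds, in_or_app; right; left.
    + intros i j d [ltij ltj].
      rewrite <- (app_nth1 l [p] d (n := i)), <- (app_nth1 l [p] d (n := j)) by lia.
      apply disj; rewrite length_app; simpl; lia.
    + intros q inq; destruct (In_nth _ _ p inq) as (i & lti & <-).
      specialize (disj i (length l) p); rewrite app_nth1, nth_middle in disj by easy.
      apply disj; rewrite length_app; simpl; lia.
  - intros ((bounds & disj) & bp & disjp); split.
    + intros q [inq|[<-|[]]]%in_app_or; auto.
    + intros i j d [ltij ltj]; rewrite length_app in ltj; simpl in ltj.
      rewrite (app_nth1 l [p] d (n := i)) by lia.
      destruct (Nat.eq_dec j (length l)) as [->|ne].
      * rewrite nth_middle; apply disjp, nth_In; lia.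
      * rewrite app_nth1 by lia; apply disj; lia.
Qed.

Lemma pheight_ge (l : list placed) (p : placed) : In p l -> top p <= pheight l.
Proof.
  unfold pheight, top; induction l as [|q l IH]; simpl; [tauto|].
  intros [->|inp]; [apply Rmax_l|].
  eapply Rle_trans; [now apply IH|apply Rmax_r].
Qed.

Lemma pheight_le (l : list placed) (h : R) :
  0 <= h -> Forall (fun p => top p <= h) l -> pheight l <= h.
Proof.
  unfold pheight, top; intros h0; induction 1; simpl; [easy|].
  now apply Rmax_lub.
Qed.

Definition lowest_left (W : R) (l : list placed) (p : placed) : Prop :=
  feasible W (l ++ [p]) /\
  forall x y, feasible W (l ++ [(prect p, (x, y))]) ->
    lex_le (py p, px p) (y, x).

(** Splitting the list in place of indexing it lets an induction move the head of the remaining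
    rectangles to the end of the placed ones. *)
Lemma BL_packing_alt (W : R) (l : list placed) :
  BL_packing W l <->
  (forall p l', l = p :: l' -> px p = 0 /\ py p = 0) /\
  (forall l1 p l2, l = l1 ++ p :: l2 -> lowest_left W l1 p).
Proof.
  split; intros [first steps]; split; auto.
  - intros l1 p l2 ->.
    specialize (steps (length l1) p); rewrite length_app, nth_middle in steps.
    rewrite firstn_app, Nat.sub_diag, firstn_all, firstn_O, app_nil_r in steps.
    apply steps; simpl; lia.
  - intros k d ltk p.
    destruct (nth_split l d ltk) as (l1 & l2 & eql & len1).
    apply (steps _ _ l2).
    rewrite eql at 1; f_equal.
    now rewrite eql, <- len1, firstn_app, Nat.sub_diag, firstn_all, firstn_O, app_nil_r.
Qed.

(** Supplies the coordinate to which a rectangle slides: the last edge at or before [v], or the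
    border 0 if there is none. *)
Lemma greatest_below (l : list R) (v : R) :
  0 <= v ->
  exists u, In u (0 :: l) /\ 0 <= u <= v /\
    forall t, In t l -> t <= v -> t <= u.
Proof.
  intros v0; induction l as [|a l (u & inu & uv & maxu)].
  - exists 0; simpl; split; [tauto|split; [lra|tauto]].
  - destruct (Rle_dec a v) as [av|nav], (Rle_dec u a) as [ua|nua].
    1: exists a; simpl; repeat split; [tauto|lra|lra|].
    2-4: exists u; simpl in *; repeat split; [tauto|lra|lra|].
    all: intros t [<-|int] tv; try lra; specialize (maxu t int tv); lra.
Qed.

(* Push the new rectangle down, then to the left. *)
Lemma corner_below (W : R) (l : list placed) (r : rect) (x y : R) :
  Forall positive l -> 0 < rw r -> 0 < rh r ->
  feasible W (l ++ [(r, (x, y))]) ->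
  exists x' y', In x' (0 :: map right l) /\ In y' (0 :: map top l) /\
    feasible W (l ++ [(r, (x', y'))]) /\ lex_le (y', x') (y, x).
Proof.
  intros posl rw0 rh0 (feasl & (x0 & xW & y0) & disj)%feasible_snoc.
  rewrite Forall_forall in posl.
  unfold right, px, py, prect in x0, xW, y0; simpl in x0, xW, y0.
  destruct (greatest_below (map right l) x x0) as (x' & inx & x'x & maxx).
  destruct (greatest_below (map top l) y y0) as (y' & iny & y'y & maxy).
  exists x', y'; split; [easy|]; split; [easy|]; split.
  - apply feasible_snoc; split; [easy|]; split.
    { unfold in_strip, right, px, py, prect; simpl; lra. }
    intros q inq; apply disjoint_separated; [now apply posl|easy|].
    specialize (disj q inq).
    apply disjoint_separated in disj; [|now apply posl|easy].
    specialize (maxx _ (in_map right _ _ inq)).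
    specialize (maxy _ (in_map top _ _ inq)).
    (* If [q] lies to the left of the new rectangle or below it, the maximality of [x'] or [y']
       keeps it there. In the other two cases [x' <= x] or [y' <= y] suffices. *)
    unfold separated, right, top, px, py, prect in *; simpl in *; lra.
  - unfold lex_le; simpl.
    destruct (Rlt_dec y' y) as [|ge]; [now left|right; lra].
Qed.

(** * The grid *)

(* The level [(a, b)] stands for the height [a - b * mu]. *)
Definition level : Type := (Z * Z)%type.

Definition level_add (u v : level) : level := (fst u + fst v, snd u + snd v)%Z.

Definition level_leb (u v : level) : bool :=
  ((fst u <? fst v) || ((fst u =? fst v) && (snd v <=? snd u)))%Z.

(* For such levels and [mu <= 1 / 10], [level_leb] is the order of the heights. *)
Definition level_ok (u : level) : bool := ((0 <=? snd u) && (snd u <=? 9))%Z.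

Definition level_val (mu : R) (u : level) : R := IZR (fst u) - IZR (snd u) * mu.

Definition box : Type := (Z * level)%type.
Definition gplaced : Type := (box * (Z * level))%type.

Definition box_val (mu : R) (b : box) : rect := (IZR (fst b), level_val mu (snd b)).

Definition gval (mu : R) (p : gplaced) : placed :=
  (box_val mu (fst p), (IZR (fst (snd p)), level_val mu (snd (snd p)))).

Definition gright (p : gplaced) : Z := (fst (snd p) + fst (fst p))%Z.
Definition gtop (p : gplaced) : level := level_add (snd (snd p)) (snd (fst p)).

(* Conditionals instead of [||] and [&&]: [vm_compute] evaluates all the arguments
   of a function, also where the first one determines the result. *)
Definition gseparated (p q : gplaced) : bool :=
  if (gright p <=? fst (snd q))%Z then true else
  if (gright q <=? fst (snd p))%Z then true else
  if level_leb (gtop p) (snd (snd q)) then true else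
  level_leb (gtop q) (snd (snd p)).

Fixpoint all_separated (pl : list gplaced) (p : gplaced) : bool :=
  match pl with
  | [] => true
  | q :: pl' => if gseparated q p then all_separated pl' p else false
  end.

Definition gfits (W : Z) (pl : list gplaced) (p : gplaced) : bool :=
  if (gright p <=? W)%Z then
    if all_separated pl p then
      (0 <=? fst (snd p))%Z && level_leb (0, 0)%Z (snd (snd p))
    else false
  else false.

Definition gok (p : gplaced) : bool :=
  (0 <? fst (fst p))%Z && negb (level_leb (snd (fst p)) (0, 0)%Z) &&
  level_ok (snd (fst p)) && level_ok (snd (snd p)) && level_ok (gtop p).

Definition corners (pl : list gplaced) (b : box) : list gplaced :=
  map (pair b) (list_prod (0%Z :: map gright pl) ((0, 0)%Z :: map gtop pl)).

Definition lex_leb (p q : gplaced) : bool :=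
  negb (level_leb (snd (snd q)) (snd (snd p))) ||
  (level_leb (snd (snd p)) (snd (snd q)) && (fst (snd p) <=? fst (snd q))%Z).

Fixpoint lex_min (l : list gplaced) : option gplaced :=
  match l with
  | [] => None
  | p :: l' =>
      match lex_min l' with
      | None => Some p
      | Some m => if lex_leb p m then Some p else Some m
      end
  end.

Definition bl_place (W : Z) (pl : list gplaced) (b : box) : option gplaced :=
  lex_min (filter (gfits W pl) (corners pl b)).

(** Turns the order into linear integer arithmetic, so that [lia] settles its totality and
    transitivity in [lex_min_spec]. *)
Lemma lex_leb_Z (p q : gplaced) :
  lex_leb p q = true <->
  let '(x, (a, b)) := snd p in let '(x', (a', b')) := snd q in
  (a < a' \/ a = a' /\ (b' < b \/ b = b' /\ x <= x'))%Z.
Proof.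
  destruct p as [? [x [a b]]], q as [? [x' [a' b']]].
  unfold lex_leb, level_leb; simpl.
  rewrite orb_true_iff, negb_true_iff, <- not_true_iff_false, andb_true_iff.
  rewrite !orb_true_iff, !andb_true_iff, !Z.ltb_lt, !Z.eqb_eq, !Z.leb_le; lia.
Qed.

Lemma lex_min_spec (l : list gplaced) :
  match lex_min l with
  | None => l = []
  | Some m => In m l /\ forall p, In p l -> lex_leb m p = true
  end.
Proof.
  induction l as [|p l IH]; simpl; [easy|].
  destruct (lex_min l) as [m|]; [destruct IH as [inm minm]|subst l].
  - destruct (lex_leb p m) eqn:pm; (split; [now auto|]).
    all: intros q [<-|inq]; try (specialize (minm q inq)); try easy.
    all: revert pm; try rewrite <- not_true_iff_false; rewrite lex_leb_Z.
    all: try (apply lex_leb_Z in minm; revert minm); rewrite ?lex_leb_Z.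
    all: repeat match goal with p : gplaced |- _ => destruct p as [? [? [? ?]]] end.
    all: simpl; lia.
  - split; [now left|]; intros q [<-|[]]; apply lex_leb_Z.
    destruct p as [? [? [? ?]]]; simpl; lia.
Qed.


(** * Agreement of the grid with the real packings *)

Lemma level_val_add (mu : R) (u v : level) :
  level_val mu (level_add u v) = level_val mu u + level_val mu v.
Proof. unfold level_val, level_add; simpl; rewrite !plus_IZR; ring. Qed.

(** Both corrections by multiples of [mu] lie in [0, 9/10], so they cannot outweigh a difference of
    at least 1 between integer parts. With equal integer parts, the larger multiple of [mu] is the
    lower height. *)
Lemma level_leb_spec (mu : R) (u v : level) :
  0 < mu <= 1 / 10 -> level_ok u = true -> level_ok v = true ->
  level_leb u v = true <-> level_val mu u <= level_val mu v.
Proof.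
  unfold level_ok, level_leb, level_val; destruct u as [a b], v as [c d]; simpl.
  rewrite !andb_true_iff, orb_true_iff, andb_true_iff, !Z.leb_le, Z.ltb_lt, Z.eqb_eq.
  intros small [b0 b9] [d0 d9].
  pose proof (IZR_le _ _ b0); pose proof (IZR_le _ _ b9).
  pose proof (IZR_le _ _ d0); pose proof (IZR_le _ _ d9).
  assert (0 <= IZR b * mu <= 9 / 10) by nra.
  assert (0 <= IZR d * mu <= 9 / 10) by nra.
  destruct (Z.lt_trichotomy a c) as [lt|[->|gt]].
  - assert (le : (a + 1 <= c)%Z) by lia; apply IZR_le in le; rewrite plus_IZR in le.
    split; [lra|tauto].
  - split.
    + intros [?|[_ le%IZR_le]]; [lia|nra].
    + intros le; right; split; [easy|].
      apply Z.le_ngt; intros lt%IZR_lt; nra.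
  - assert (le : (c + 1 <= a)%Z) by lia; apply IZR_le in le; rewrite plus_IZR in le.
    split; [lia|lra].
Qed.

Lemma right_gval (mu : R) (p : gplaced) : right (gval mu p) = IZR (gright p).
Proof. unfold right, gright; rewrite plus_IZR; reflexivity. Qed.

Lemma top_gval (mu : R) (p : gplaced) : top (gval mu p) = level_val mu (gtop p).
Proof. unfold top, gtop; rewrite level_val_add; reflexivity. Qed.

Lemma gok_spec (p : gplaced) :
  gok p = true ->
  (0 < fst (fst p))%Z /\ level_leb (snd (fst p)) (0, 0)%Z = false /\
  level_ok (snd (fst p)) = true /\ level_ok (snd (snd p)) = true /\
  level_ok (gtop p) = true.
Proof. unfold gok; rewrite !andb_true_iff, negb_true_iff, Z.ltb_lt; tauto. Qed.

Lemma level_val0 (mu : R) : level_val mu (0, 0)%Z = 0.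
Proof. unfold level_val; simpl; ring. Qed.

Lemma gok_positive (mu : R) (p : gplaced) :
  0 < mu <= 1 / 10 -> gok p = true -> positive (gval mu p).
Proof.
  intros small (w0 & h0 & okh & _)%gok_spec; split; [now apply (IZR_lt 0)|].
  apply Rnot_le_lt; intros le; change (level_val mu (snd (fst p)) <= 0) in le.
  rewrite <- (level_val0 mu) in le.
  apply level_leb_spec in le; [congruence|easy..].
Qed.

Lemma gseparated_spec (mu : R) (p q : gplaced) :
  0 < mu <= 1 / 10 -> gok p = true -> gok q = true ->
  gseparated p q = true <-> separated (gval mu p) (gval mu q).
Proof.
  intros small okp okq; unfold gseparated, separated.
  apply gok_spec in okp, okq.
  rewrite !right_gval, !top_gval.
  unfold px, py, gval; simpl.
  rewrite <- !(level_leb_spec mu) by tauto.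
  destruct (Z.leb_spec (gright p) (fst (snd q))) as [le%IZR_le|lt%IZR_lt]; [tauto|].
  destruct (Z.leb_spec (gright q) (fst (snd p))) as [le'%IZR_le|lt'%IZR_lt]; [tauto|].
  destruct (level_leb (gtop p) (snd (snd q))); [tauto|].
  split; [tauto|]; intros [?|[?|[?|?]]]; try lra; easy.
Qed.

Lemma all_separated_spec (pl : list gplaced) (p : gplaced) :
  all_separated pl p = true <-> forall q, In q pl -> gseparated q p = true.
Proof.
  rewrite <- forallb_forall.
  induction pl as [|q pl IH]; simpl; [easy|].
  now destruct (gseparated q p).
Qed.

Lemma gfits_spec (mu : R) (W : Z) (pl : list gplaced) (p : gplaced) :
  0 < mu <= 1 / 10 -> Forall (fun q => gok q = true) pl -> gok p = true ->
  feasible (IZR W) (map (gval mu) pl) ->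
  gfits W pl p = true <-> feasible (IZR W) (map (gval mu) pl ++ [gval mu p]).
Proof.
  intros small okpl okp feas; rewrite feasible_snoc.
  rewrite Forall_forall in okpl.
  (* Nested conditionals and [&&] are convertible. *)
  change (gfits W pl p) with ((gright p <=? W)%Z && (all_separated pl p &&
    ((0 <=? fst (snd p))%Z && level_leb (0, 0)%Z (snd (snd p))))).
  rewrite !andb_true_iff, !Z.leb_le, all_separated_spec; unfold in_strip.
  rewrite (level_leb_spec mu), level_val0 by (try apply gok_spec in okp; easy || tauto).
  rewrite right_gval.
  split.
  - intros (xW%IZR_le & sep & x0%IZR_le & y0); split; [easy|]; split; [easy|].
    intros q' (q & <- & inq)%in_map_iff.
    apply disjoint_separated; try apply gok_positive; auto.
    apply gseparated_spec; auto.
  - intros (_ & (x0 & xW & y0) & disj).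
    split; [now apply le_IZR|]; split; [|split; [now apply le_IZR|easy]].
    intros q inq; apply (gseparated_spec mu); auto.
    apply disjoint_separated; try apply gok_positive; auto.
    now apply disj, in_map.
Qed.

Lemma lex_leb_spec (mu : R) (p q : gplaced) :
  0 < mu <= 1 / 10 -> gok p = true -> gok q = true ->
  lex_leb p q = true <->
  lex_le (py (gval mu p), px (gval mu p)) (py (gval mu q), px (gval mu q)).
Proof.
  intros small okp okq; unfold lex_leb, lex_le.
  apply gok_spec in okp, okq.
  destruct p as [bp [xp yp]], q as [bq [xq yq]].
  unfold px, py, gval; simpl in *.
  rewrite orb_true_iff, andb_true_iff, negb_true_iff, Z.leb_le.
  rewrite <- not_true_iff_false, !(level_leb_spec mu) by tauto.
  split.
  - intros [gt|[le lex%IZR_le]]; lra.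
  - intros [lt|[eq le%le_IZR]]; [left|right]; [lra|split; [lra|easy]].
Qed.

Lemma corners_complete (mu : R) (pl : list gplaced) (b : box) (x y : R) :
  In x (0 :: map right (map (gval mu) pl)) ->
  In y (0 :: map top (map (gval mu) pl)) ->
  exists c, In c (corners pl b) /\ gval mu c = (box_val mu b, (x, y)).
Proof.
  intros inx iny.
  assert (inx' : exists x', In x' (0%Z :: map gright pl) /\ IZR x' = x).
  { destruct inx as [<-|inx]; [exists 0%Z; simpl; tauto|].
    rewrite map_map, in_map_iff in inx; destruct inx as (q & <- & inq).
    exists (gright q); rewrite right_gval; split; [right; now apply in_map|easy]. }
  assert (iny' : exists y', In y' ((0, 0)%Z :: map gtop pl) /\ level_val mu y' = y).
  { destruct iny as [<-|iny]; [exists (0, 0)%Z; rewrite level_val0; simpl; tauto|].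
    rewrite map_map, in_map_iff in iny; destruct iny as (q & <- & inq).
    exists (gtop q); rewrite top_gval; split; [right; now apply in_map|easy]. }
  destruct inx' as (x' & inx' & <-), iny' as (y' & iny' & <-).
  exists (b, (x', y')); split; [|reflexivity].
  now apply in_map, in_prod.
Qed.

Lemma corners_box (pl : list gplaced) (b : box) (c : gplaced) :
  In c (corners pl b) -> fst c = b.
Proof. now intros (xy & <- & _)%in_map_iff. Qed.

Lemma bl_place_spec (W : Z) (pl : list gplaced) (b : box) :
  match bl_place W pl b with
  | None => forall c, In c (corners pl b) -> gfits W pl c = false
  | Some m =>
      In m (corners pl b) /\ gfits W pl m = true /\
      forall c, In c (corners pl b) -> gfits W pl c = true -> lex_leb m c = true
  end.
Proof.
  unfold bl_place; pose proof (lex_min_spec (filter (gfits W pl) (corners pl b))) as spec.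
  destruct (lex_min _) as [m|].
  - destruct spec as [[inm fits]%filter_In minm]; split; [easy|]; split; [easy|].
    intros c inc fitsc; apply minm, filter_In; auto.
  - intros c inc; apply not_true_iff_false; intros fitsc.
    assert (infil : In c (filter (gfits W pl) (corners pl b)))
      by (apply filter_In; auto).
    now rewrite spec in infil.
Qed.

Lemma lex_le_antisym (a b : R * R) : lex_le a b -> lex_le b a -> a = b.
Proof.
  destruct a, b; unfold lex_le; simpl; intros ab ba; f_equal; lra.
Qed.

Lemma lex_le_trans (a b c : R * R) : lex_le a b -> lex_le b c -> lex_le a c.
Proof. unfold lex_le; lra. Qed.

Lemma lowest_left_unique (W : R) (l : list placed) (p q : placed) :
  prect p = prect q -> lowest_left W l p -> lowest_left W l q -> p = q.
Proof.
  destruct p as [r [x y]], q as [r' [x' y']]; unfold prect; simpl; intros <-.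
  intros [feasp minp] [feasq minq].
  pose proof (lex_le_antisym _ _ (minp _ _ feasq) (minq _ _ feasp)) as eq.
  unfold px, py in eq; simpl in eq; congruence.
Qed.

(** The bridge from the algorithm to computation. By [corner_below] every feasible real position is
    dominated by a feasible corner, and among corners the integer tests are exact. Hence the
    computed corner is lowest-left, and uniqueness of the lexicographic minimum gives the
    converse. *)
Lemma bl_place_lowest_left (mu : R) (W : Z) (pl : list gplaced) (b : box) (p : placed) :
  0 < mu <= 1 / 10 -> Forall (fun q => gok q = true) pl ->
  forallb gok (corners pl b) = true ->
  feasible (IZR W) (map (gval mu) pl) -> prect p = box_val mu b ->
  lowest_left (IZR W) (map (gval mu) pl) p <->
  exists c, bl_place W pl b = Some c /\ p = gval mu c.
Proof.
  intros small okpl okc feas boxp; rewrite forallb_forall in okc.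
  assert (below : forall x y,
    feasible (IZR W) (map (gval mu) pl ++ [(box_val mu b, (x, y))]) ->
    exists c, In c (corners pl b) /\ gfits W pl c = true /\
      lex_le (py (gval mu c), px (gval mu c)) (y, x)).
  { intros x y feasxy.
    (* The origin is always among the corners. Since it passes [gok], the box [b] has positive
       sizes. *)
    destruct (corners_complete mu pl b 0 0) as (c0 & inc0 & _); [now left..|].
    pose proof (gok_positive mu c0 small (okc _ inc0)) as [w0 h0].
    apply corners_box in inc0.
    unfold gval, prect in w0, h0; simpl in w0, h0; rewrite inc0 in w0, h0.
    apply corner_below in feasxy; [|apply Forall_map|easy..].
    - destruct feasxy as (x' & y' & inx & iny & feasxy & lex).
      destruct (corners_complete mu pl b _ _ inx iny) as (c & inc & valc).
      exists c; split; [easy|]; rewrite valc; split; [|easy].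
      apply (gfits_spec mu); auto; now rewrite valc.
    - revert okpl; apply Forall_impl; intros q; now apply gok_positive. }
  assert (sound : forall c, bl_place W pl b = Some c ->
    lowest_left (IZR W) (map (gval mu) pl) (gval mu c)).
  { intros c placec; pose proof (bl_place_spec W pl b) as spec; rewrite placec in spec.
    destruct spec as (inc & fitsc & minc); split; [now apply gfits_spec; auto|].
    intros x y feasxy; unfold gval, prect in feasxy; simpl in feasxy.
    rewrite (corners_box _ _ _ inc) in feasxy.
    destruct (below x y feasxy) as (c' & inc' & fitsc' & lec').
    eapply lex_le_trans; [|exact lec'].
    apply lex_leb_spec; auto. }
  split; [|intros (c & placec & ->); auto].
  intros ll; pose proof (bl_place_spec W pl b) as spec.
  destruct p as [r [x y]]; unfold prect in boxp; simpl in boxp; subst r.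
  destruct (below x y (proj1 ll)) as (c' & inc' & fitsc' & _).
  destruct (bl_place W pl b) as [c|]; [|now rewrite spec in fitsc'].
  exists c; split; [easy|]; apply lowest_left_unique with (2 := ll); [|now apply sound].
  unfold gval, prect; simpl; now rewrite (corners_box _ _ _ (proj1 spec)).
Qed.

(** * Exhaustive search over all orders *)

Definition box_eq_dec (b c : box) : {b = c} + {b <> c}.
Proof. repeat decide equality. Defined.

Fixpoint remove_one (b : box) (l : list box) : list box :=
  match l with
  | [] => []
  | c :: l' => if box_eq_dec c b then l' else c :: remove_one b l'
  end.

Lemma remove_one_perm (b : box) (l : list box) :
  In b l -> Permutation l (b :: remove_one b l).
Proof.
  induction l as [|c l IH]; simpl; [tauto|].
  destruct (box_eq_dec c b) as [->|ne]; [easy|].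
  intros [eq|inb]; [easy|]; rewrite (IH inb) at 1; apply perm_swap.
Qed.

(** [n] is fuel. A branch succeeds as soon as some top reaches [h], and fails if the boxes or the
    fuel run out first. A box without a feasible corner succeeds vacuously, since no bottom-left run
    continues with it. Equal boxes give equal branches, hence [nodup]. The test of [gok] on all
    corners certifies along the way that the integer comparisons are valid. *)
Fixpoint all_runs_reach (W : Z) (h : level) (n : nat)
    (pl : list gplaced) (rem : list box) : bool :=
  match n, rem with
  | S n', _ :: _ =>
      forallb (fun b =>
        forallb gok (corners pl b) &&
        match bl_place W pl b with
        | None => true
        | Some c =>
            if level_leb h (gtop c) then true
            else all_runs_reach W h n' (pl ++ [c]) (remove_one b rem)
        end) (nodup box_eq_dec rem)
  | _, _ => false
  end.

(** The order of [l] selects one branch of the search: at each step the rectangle placed must be the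
    corner computed there, and the induction continues with it appended to [pl]. *)
Lemma all_runs_reach_sound (mu : R) (W : Z) (h : level) (n : nat)
    (pl : list gplaced) (rem : list box) (l : list placed) :
  0 < mu <= 1 / 10 -> level_ok h = true ->
  all_runs_reach W h n pl rem = true ->
  Forall (fun q => gok q = true) pl ->
  feasible (IZR W) (map (gval mu) pl) ->
  Permutation (map (box_val mu) rem) (map prect l) ->
  (forall l1 p l2, l = l1 ++ p :: l2 ->
     lowest_left (IZR W) (map (gval mu) pl ++ l1) p) ->
  exists p, In p l /\ level_val mu h <= top p.
Proof.
  intros small okh; revert pl rem l.
  induction n as [|n IH]; intros pl rem l; [easy|].
  intros reach okpl feas perm run.
  destruct l as [|p l].
  (* A run that is already over leaves no boxes, where the search answers [false]. *)
  { apply Permutation_sym, Permutation_nil, map_eq_nil in perm; now subst rem. }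
  assert (inb : In (prect p) (map (box_val mu) rem))
    by (rewrite perm; now left).
  apply in_map_iff in inb; destruct inb as (b & boxp & inb).
  pose proof (remove_one_perm b rem inb) as permrem.
  destruct rem as [|b0 rem]; [easy|]; cbn [all_runs_reach] in reach.
  rewrite forallb_forall in reach; specialize (reach b (proj2 (nodup_In _ _ _) inb)).
  apply andb_prop in reach; destruct reach as [okc reach].
  pose proof (run [] p l eq_refl) as ll; rewrite app_nil_r in ll.
  pose proof ll as [feasp _].
  apply (bl_place_lowest_left mu W pl b) in ll; auto.
  destruct ll as (c & placec & ->).
  pose proof (bl_place_spec W pl b) as spec; rewrite placec in reach, spec.
  rewrite forallb_forall in okc.
  pose proof (okc c (proj1 spec)) as okcc.
  destruct (level_leb h (gtop c)) eqn:high.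
  - exists (gval mu c); split; [now left|]; rewrite top_gval.
    apply level_leb_spec; auto; now apply gok_spec in okcc.
  - destruct (IH (pl ++ [c]) (remove_one b (b0 :: rem)) l) as (q & inq & topq); auto.
    + apply Forall_app; auto.
    + now rewrite map_app.
    + apply Permutation_cons_inv with (a := prect (gval mu c)).
      change (prect (gval mu c) :: map prect l) with (map prect (gval mu c :: l)).
      rewrite <- perm, <- boxp; symmetry; exact (Permutation_map _ permrem).
    + intros l1 q l2 ->; rewrite map_app, <- app_assoc.
      apply (run (gval mu c :: l1) q l2 eq_refl).
    + exists q; split; [now right|easy].
Qed.

(** * Checking explicit grid packings one rectangle at a time *)

Fixpoint grun (step : list gplaced -> gplaced -> Prop)
    (pl l : list gplaced) : Prop :=
  match l with
  | [] => True
  | p :: l' => step pl p /\ grun step (pl ++ [p]) l'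
  end.

Lemma grun_split (step : list gplaced -> gplaced -> Prop)
    (pl l1 l2 : list gplaced) (p : gplaced) :
  grun step pl (l1 ++ p :: l2) -> grun step pl l1 /\ step (pl ++ l1) p.
Proof.
  revert pl; induction l1 as [|q l1 IH]; intros pl [st run].
  - now rewrite app_nil_r.
  - destruct (IH _ run) as [run1 stp]; rewrite <- app_assoc in stp.
    now repeat split.
Qed.

Definition fit_step (W : Z) (pl : list gplaced) (p : gplaced) : Prop :=
  gok p = true /\ gfits W pl p = true.

Definition bl_step (W : Z) (pl : list gplaced) (p : gplaced) : Prop :=
  forallb gok (corners pl (fst p)) = true /\ bl_place W pl (fst p) = Some p.

Lemma bl_step_fit (W : Z) (pl : list gplaced) (p : gplaced) :
  bl_step W pl p -> fit_step W pl p.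
Proof.
  intros [okc place]; pose proof (bl_place_spec W pl (fst p)) as spec.
  rewrite place in spec; rewrite forallb_forall in okc.
  split; [now apply okc|apply spec].
Qed.

Lemma feasible_nil (W : R) : feasible W [].
Proof. split; simpl; [tauto|lia]. Qed.

(** Stated for any step that implies [fit_step], so that it serves both the bottom-left run and the
    optimal packing. The induction is from the right because [grun] appends each new rectangle. *)
Lemma grun_feasible (mu : R) (W : Z) (step : list gplaced -> gplaced -> Prop)
    (l : list gplaced) :
  0 < mu <= 1 / 10 -> (forall pl p, step pl p -> fit_step W pl p) ->
  grun step [] l ->
  Forall (fun q => gok q = true) l /\ feasible (IZR W) (map (gval mu) l).
Proof.
  intros small fit; induction l as [|p l IH] using rev_ind; intros run.
  - split; [easy|apply feasible_nil].
  - apply grun_split in run; destruct run as [run [okp fits]%fit].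
    destruct (IH run) as [okl feas]; split; [now apply Forall_app; auto|].
    rewrite map_app; now apply gfits_spec.
Qed.

Lemma grun_BL_packing (mu : R) (W : Z) (p0 : gplaced) (l : list gplaced) :
  0 < mu <= 1 / 10 -> snd p0 = (0, (0, 0))%Z ->
  grun (bl_step W) [] (p0 :: l) ->
  BL_packing (IZR W) (map (gval mu) (p0 :: l)).
Proof.
  intros small origin run; apply BL_packing_alt; split.
  - intros p l' eql; injection eql as <- _.
    unfold px, py, gval; rewrite origin; simpl; now rewrite level_val0.
  - intros l1 p l2 eql; apply map_eq_app in eql.
    destruct eql as (m1 & m2' & eqm & <- & eqm2).
    apply map_eq_cons in eqm2; destruct eqm2 as (q & m2 & -> & <- & _).
    rewrite eqm in run; apply grun_split in run; destruct run as [run [okc inq]].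
    destruct (grun_feasible mu W (bl_step W) m1) as [okm feas]; auto.
    { apply bl_step_fit. }
    apply (bl_place_lowest_left mu W m1 (fst q)); auto; now exists q.
Qed.

(** * The instance *)

(** Entries are ((width, height), (x, y)), with height and y as levels. The second item of width 13
    lands on the first, which gives the top [4 - 2 * mu]. *)
Definition best_run : list gplaced :=
  [((3, (1, 0)), (0, (0, 0)));
   ((13, (2, 1)), (3, (0, 0)));
   ((1, (3, 0)), (16, (0, 0)));
   ((11, (1, 0)), (17, (0, 0)));
   ((8, (1, 0)), (17, (1, 0)));
   ((13, (2, 1)), (0, (2, 1)));
   ((12, (1, 0)), (17, (2, 0)));
   ((7, (1, 0)), (25, (1, 0)))]%Z.

(** The three rows start at heights 0, 1 and 2, and the item of height 3 fills the last column. The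
    items are listed in the order of [best_run], so that both lists have the same boxes by
    computation. *)
Definition opt_packing : list gplaced :=
  [((3, (1, 0)), (13, (1, 0)));
   ((13, (2, 1)), (19, (0, 0)));
   ((1, (3, 0)), (32, (0, 0)));
   ((11, (1, 0)), (13, (2, 0)));
   ((8, (1, 0)), (24, (2, 0)));
   ((13, (2, 1)), (0, (1, 0)));
   ((12, (1, 0)), (0, (0, 0)));
   ((7, (1, 0)), (12, (0, 0)))]%Z.

Definition items : list box := map fst best_run.

Lemma map_prect_gval (mu : R) (l : list gplaced) :
  map prect (map (gval mu) l) = map (box_val mu) (map fst l).
Proof. rewrite !map_map; reflexivity. Qed.

Lemma best_run_correct : grun (bl_step 33) [] best_run.
Proof.
  repeat split; vm_compute; reflexivity.
Qed.

Lemma opt_packing_correct : grun (fit_step 33) [] opt_packing.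
Proof. repeat split; vm_compute; reflexivity. Qed.

(** The level (4, 2) is [4 - 2 * mu], and the fuel 8 is the number of items. As [mu] does not occur,
    a single search covers all its small values. *)
Lemma items_search : all_runs_reach 33 (4, 2)%Z 8 [] items = true.
(* The search is evaluated only once, at [Qed]. *)
Proof. vm_cast_no_check (eq_refl true). Qed.

Lemma best_run_height (mu : R) :
  0 < mu <= 1 / 10 -> pheight (map (gval mu) best_run) <= 4 - 2 * mu.
Proof.
  intros small; apply pheight_le; [lra|].
  repeat constructor; rewrite top_gval; unfold level_val; simpl; lra.
Qed.

Lemma opt_packing_height (mu : R) :
  0 < mu <= 1 / 10 -> pheight (map (gval mu) opt_packing) <= 3.
Proof.
  intros small; apply pheight_le; [lra|].
  repeat constructor; rewrite top_gval; unfold level_val; simpl; lra.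
Qed.

Lemma items_valid (mu : R) :
  0 < mu <= 1 / 10 -> valid_instance 33 (map (box_val mu) items).
Proof.
  intros small; split; [lra|]; split; [easy|].
  rewrite Forall_map.
  repeat apply Forall_cons; try apply Forall_nil.
  all: unfold rw, rh, box_val, level_val; simpl; lra.
Qed.

Lemma items_BL_lower (mu : R) (l : list placed) :
  0 < mu <= 1 / 10 -> Permutation (map (box_val mu) items) (map prect l) ->
  BL_packing 33 l -> 4 - 2 * mu <= pheight l.
Proof.
  intros small perm [_ run]%BL_packing_alt.
  destruct (all_runs_reach_sound mu 33 (4, 2)%Z 8 [] items l small eq_refl
    items_search (Forall_nil _) (feasible_nil _) perm run) as (p & inp & topp).
  apply Rle_trans with (top p); [exact topp|now apply pheight_ge].
Qed.

Lemma items_height_lower (mu : R) (l : list placed) :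
  packing_of (map (box_val mu) items) l -> feasible 33 l -> 3 <= pheight l.
Proof.
  intros pack [bounds _].
  (* The item of height 3 alone forces the bound. *)
  assert (inD : In (box_val mu (1, (3, 0))%Z) (map prect l))
    by (rewrite pack; apply in_map; simpl; tauto).
  apply in_map_iff in inD; destruct inD as (p & boxp & inp).
  destruct (bounds p inp) as (_ & _ & y0).
  apply Rle_trans with (top p); [|now apply pheight_ge].
  unfold top; rewrite boxp; unfold rh, box_val, level_val; simpl; lra.
Qed.

Theorem theorem4 :
  forall eps : R, 0 < eps ->
  exists (W : R) (rs : list rect) (hbl hopt : R),
    valid_instance W rs /\
    is_hBL_best W rs hbl /\ is_hOPT W rs hopt /\
    hbl / hopt >= 4 / 3 - eps.
Proof.
  (* The ratio is [4 / 3 - 2 * mu / 3], so [mu <= eps] is enough; the bound 1/10 keeps the grid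
     order valid. *)
  intros eps eps0; set (mu := Rmin eps (1 / 10)).
  assert (small : 0 < mu <= 1 / 10)
    by (split; [apply Rmin_glb_lt; lra|apply Rmin_r]).
  assert (mu_eps : mu <= eps) by apply Rmin_l.
  exists 33, (map (box_val mu) items), (4 - 2 * mu), 3.
  assert (perm : Permutation (map (box_val mu) items)
                   (map prect (map (gval mu) best_run)))
    by now rewrite map_prect_gval.
  assert (pack : packing_of (map (box_val mu) items) (map (gval mu) opt_packing))
    by apply map_prect_gval.
  assert (bl : BL_packing 33 (map (gval mu) best_run))
    by (apply (grun_BL_packing mu 33); [easy|easy|apply best_run_correct]).
  assert (feas : feasible 33 (map (gval mu) opt_packing))
    by (eapply (grun_feasible mu 33); eauto using opt_packing_correct).
  split; [now apply items_valid|]; split; [|split].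
  - split; [exists (map (gval mu) best_run)|intros l; now apply items_BL_lower].
    split; [easy|]; split; [easy|]; apply Rle_antisym.
    + now apply best_run_height.
    + now apply items_BL_lower.
  - split; [exists (map (gval mu) opt_packing)|intros l; apply items_height_lower].
    split; [easy|]; split; [easy|]; apply Rle_antisym.
    + now apply opt_packing_height.
    + now apply (items_height_lower mu).
  - lra.
Qed.
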